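(* Let $h_1,\dots,h_n\in\mathbb{R}\setminus\{0\}$ and let $\pi=(\pi_1,\dots,\pi_n)$ be the row vector with $\pi_i=|h_i|/\sum_j|h_j|$. Let $\mathbf{P}_1,\dots,\mathbf{P}_k$ be $n\times n$ transition matrices with $\pi\mathbf{P}_i=\pi$ for all $1\le i\le k$, and let $\Theta_1,\dots,\Theta_k$ be real numbers with $0\le\Theta_i\le1$ for all $i$ and $\sum_{i=1}^k\Theta_i=1$. Then $\mathbf{P}=\sum_{i=1}^k\Theta_i\mathbf{P}_i$ is a transition matrix that also satisfies $\pi\mathbf{P}=\pi$.
   Context: A transition matrix is a square real matrix with entries in $[0,1]$ whose rows each sum to $1$. *)

(* Defs.v *)
From mathcomp Require Import all_boot all_order all_algebra.
From mathcomp Require Import reals.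

Set Implicit Arguments.
Unset Strict Implicit.
Unset Printing Implicit Defensive.

Import Order.TTheory GRing.Theory Num.Theory.

Local Open Scope ring_scope.

Definition transition_mx (R : realType) (n : nat) (P : 'M[R]_n) : Prop :=
  (forall i j, 0 <= P i j <= 1) /\ (forall i, \sum_j P i j = 1).

Definition abs_weights (R : realType) (n : nat) (h : 'I_n -> R) : 'rV[R]_n :=
  \row_i (`|h i| / \sum_j `|h j|).

(* Main.v *)
Require Import Defs.
From mathcomp Require Import all_boot all_order all_algebra.
From mathcomp Require Import reals.

Import Order.TTheory GRing.Theory Num.Theory.

Local Open Scope ring_scope.

(** Each requirement on a matrix is a linear equation or inequality in its entries, so it survives
    averaging with nonnegative weights of sum 1. In each case a constant is spread over the weights
    through [Theta_sum], and the claim is then checked for each [l]. *)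

Theorem theorem5p2 (R : realType) (n k : nat) (h : 'I_n -> R)
    (P : 'I_k -> 'M[R]_n) (Theta : 'I_k -> R)
    (h_neq0 : forall i, h i != 0)
    (P_transition : forall i, transition_mx (P i))
    (P_stationary : forall i, abs_weights h *m P i = abs_weights h)
    (Theta_itv : forall i, 0 <= Theta i <= 1)
    (Theta_sum : \sum_i Theta i = 1) :
  transition_mx (\sum_i Theta i *: P i) /\
  abs_weights h *m (\sum_i Theta i *: P i) = abs_weights h.
Proof.
have PE i j : (\sum_l Theta l *: P l) i j = \sum_l Theta l * P l i j.
  by rewrite summxE; apply: eq_bigr => l _; rewrite mxE.
split; last first.
  (* The right side becomes [\sum_l Theta l *: abs_weights h], to be matched termwise. *)
  rewrite mulmx_sumr -[RHS]scale1r -Theta_sum scaler_suml.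
  by apply: eq_bigr => l _; rewrite -scalemxAr P_stationary.
split=> [i j | i].
  rewrite PE; apply/andP; split.
    apply: sumr_ge0 => l _; have /andP[Theta_ge0 _] := Theta_itv l.
    by have /andP[P_ge0 _] := (P_transition l).1 i j; apply: mulr_ge0.
  (* With 1 written as the sum of the weights, it remains that [Theta l * P l i j <= Theta l]. *)
  rewrite -Theta_sum; apply: ler_sum => l _.
  have /andP[Theta_ge0 _] := Theta_itv l.
  by have /andP[_ P_le1] := (P_transition l).1 i j; apply: ler_piMr.
under eq_bigr do rewrite PE.
(* Summing over [j] first leaves [Theta l] times a row sum of [P l]. *)
rewrite exchange_big -[RHS]Theta_sum; apply: eq_bigr => l _.
by rewrite -mulr_sumr (P_transition l).2 mulr1.
Qed.
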